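(* Let $X$ be a Banach space having the $\lambda$-BSAP for some $\lambda\geq 1$ such that the injective tensor product $X\widehat{\otimes}_\varepsilon X$ has property (C). Then $(B_{X^*},w^* )$ belongs to the class MS.
   Context: All Banach spaces are real; an operator is a continuous linear map. $(B_{X^*},w^* )$ is the closed unit ball of $X^*$ with the weak$^*$ topology. A Banach space $Z$ has (Corson's) property (C) if every family of convex closed subsets of $Z$ with empty intersection has a countable subfamily with empty intersection. A Banach space $Z$ has the $\lambda$-bounded separable approximation property ($\lambda$-BSAP), $\lambda\ge 1$, if the identity operator on $Z$ belongs to the closure of $\lambda B_{\mathcal{L}(Z)}\cap\mathcal{S}(Z)$ in the strong operator topology (the topology of pointwise norm convergence on $Z$), where $\mathcal{L}(Z)$ is the Banach space of operators from $Z$ to $Z$, $B_{\mathcal{L}(Z)}$ its closed unit ball, and $\mathcal{S}(Z)$ the set of those operators with separable range. A compact (Hausdorff) space $K$ belongs to the class MS if every regular Borel probability measure $\mu$ on $K$ has countable Maharam type, i.e. $L_1(\mu)$ is separable. *)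

(* Defs.v *)
From HB Require Import structures.
From mathcomp Require Import all_boot all_order all_algebra.
From mathcomp Require Import all_classical all_reals all_analysis.
Set Implicit Arguments.
Unset Strict Implicit.
Unset Printing Implicit Defensive.
Import Order.TTheory GRing.Theory Num.Theory.
Import numFieldNormedType.Exports.
Local Open Scope classical_set_scope.
Local Open Scope ring_scope.

Section Operator.
Context {R : realType} (E F : normedModType R).

Definition is_operator : {pred (E -> F)} :=
  mem [set f : E -> F | linear f /\ continuous f].

Record operator := Operator {
  operator_fun :> E -> F;
  operator_funP : operator_fun \in is_operator }.

HB.instance Definition _ := [isSub for operator_fun].
HB.instance Definition _ := [Choice of operator by <:].

Lemma is_operator_submod_closed : submod_closed is_operator.
Proof.
split=> [|a f g].
  by rewrite inE; split => [a x y|x]; [rewrite /= scaler0 addr0 | exact: cvg_cst].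
rewrite !inE => -[lf cf] [lg cg]; split=> [b x y|x].
  rewrite /= !fctE lf lg !scalerDr addrACA; congr (_ + _).
  by congr (_ + _); rewrite !scalerA mulrC.
by apply: cvgD (cg x); apply: cvgZl_tmp (cf x).
Qed.

HB.instance Definition _ := GRing.isSubmodClosed.Build R (E -> F) is_operator
  is_operator_submod_closed.
HB.instance Definition _ := [SubChoice_isSubLmodule of operator by <:].

Lemma operator_linear (T : operator) : linear T.
Proof. by have := operator_funP T; rewrite inE => -[]. Qed.

Lemma operator_continuous (T : operator) : continuous T.
Proof. by have := operator_funP T; rewrite inE => -[]. Qed.

HB.instance Definition _ (T : operator) :=
  GRing.isLinear.Build R E F *:%R (operator_fun T) (operator_linear T).

Lemma operatorDE (S T : operator) x : (S + T) x = S x + T x.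
Proof. by []. Qed.

Lemma operatorZE (a : R) (T : operator) x : (a *: T) x = a *: T x.
Proof. by []. Qed.

Lemma operatorBE (S T : operator) x : (S - T) x = S x - T x.
Proof. by []. Qed.

Lemma operator_sumE (I : Type) (s : seq I) (T : I -> operator) x :
  (\sum_(i <- s) T i) x = \sum_(i <- s) T i x.
Proof. by elim: s => [|i s IH]; rewrite ?big_nil// !big_cons -IH. Qed.

Lemma operatorP (S T : operator) : S =1 T -> S = T.
Proof. by move=> ST; apply/val_inj/funext. Qed.

Definition opnorm (T : operator) : R :=
  sup [set `|T x| | x in [set x : E | `|x| <= 1]].

Lemma opnorm_has_sup (T : operator) :
  has_sup [set `|T x| | x in [set x : E | `|x| <= 1]].
Proof.
split; first by exists `|T 0|, 0; rewrite //= normr0.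
have /linear_bounded_continuous/bounded_funP/(_ 1)[M TM] := @operator_continuous T.
by exists M => _ [x x1 <-]; exact: TM.
Qed.

Lemma le_opnorm (T : operator) (x : E) : `|T x| <= opnorm T * `|x|.
Proof.
have [->|x0] := eqVneq x 0; first by rewrite linear0 !normr0 mulr0.
rewrite -ler_pdivrMr ?normr_gt0// mulrC.
rewrite -[X in X * _ <= _]ger0_norm ?invr_ge0// -normrZ -linearZ.
apply: (sup_upper_bound (opnorm_has_sup T)); exists (`|x|^-1 *: x) => //=.
by rewrite normfZV.
Qed.

Lemma opnorm_le (T : operator) (M : R) :
  (forall x, `|x| <= 1 -> `|T x| <= M) -> opnorm T <= M.
Proof.
move=> TM; apply: ge_sup; first by case: (opnorm_has_sup T).
by move=> _ [x x1 <-]; exact: TM.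
Qed.

Lemma opnorm_ge0 (T : operator) : 0 <= opnorm T.
Proof.
apply: le_trans (normr_ge0 (T 0)) _; apply: (sup_upper_bound (opnorm_has_sup T)).
by exists 0; rewrite //= normr0.
Qed.

Lemma le_opnorm1 (T : operator) (x : E) : `|x| <= 1 -> `|T x| <= opnorm T.
Proof.
by move=> x1; apply: le_trans (le_opnorm T x) _; rewrite ler_piMr ?opnorm_ge0.
Qed.

Lemma ler_opnormD (S T : operator) : opnorm (S + T) <= opnorm S + opnorm T.
Proof.
apply: opnorm_le => x x1; rewrite operatorDE.
by apply: le_trans (ler_normD _ _) _; rewrite lerD ?le_opnorm1.
Qed.

Lemma opnormZ (a : R) (T : operator) : opnorm (a *: T) = `|a| * opnorm T.
Proof.
have leZ (b : R) (S : operator) : opnorm (b *: S) <= `|b| * opnorm S.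
  by apply: opnorm_le => x x1; rewrite operatorZE normrZ ler_wpM2l ?le_opnorm1.
apply/eqP; rewrite eq_le leZ/=; have [->|a0] := eqVneq a 0.
  by rewrite normr0 mul0r opnorm_ge0.
rewrite -ler_pdivlMl ?normr_gt0// -normfV.
by apply: le_trans (leZ _ _); rewrite scalerA mulVf// scale1r.
Qed.

Lemma opnorm0_eq0 (T : operator) : opnorm T = 0 -> T = 0.
Proof.
move=> T0; apply: operatorP => x; apply/normr0_eq0/eqP.
by rewrite eq_le normr_ge0 andbT; have := le_opnorm T x; rewrite T0 mul0r.
Qed.

HB.instance Definition _ :=
  @Lmodule_isNormed.Build R operator opnorm ler_opnormD opnormZ opnorm0_eq0.

Lemma operator_normE (T : operator) :
  `|T| = sup [set `|T x| | x in [set x : E | `|x| <= 1]].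
Proof. by []. Qed.

Lemma le_operator_dist (S T : operator) x : `|S x - T x| <= `|S - T| * `|x|.
Proof. exact: le_opnorm (S - T) x. Qed.

End Operator.

Section OperatorComplete.
Context {R : realType} (E : normedModType R) (F : completeNormedModType R).

Lemma operator_complete (G : set_system (operator E F)) :
  ProperFilter G -> cauchy G -> cvg G.
Proof.
move=> GF /cauchyP Gc.
have appc x : cvg ((fun T : operator E F => T x) @ G).
  apply: cauchy_cvg; apply/cauchyP => e e0.
  have d0 : 0 < e / (`|x| + 1) by rewrite divr_gt0// ltr_wpDl.
  have [T0 GT0] := Gc _ d0; exists (T0 x).
  change (G [set T : operator E F | ball (T0 x) e (T x)]).
  apply: filterS GT0 => T; rewrite /= -!ball_normE /ball_/= => T0T.
  apply: le_lt_trans (le_operator_dist _ _ _) _.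
  apply: (@le_lt_trans _ _ (`|T0 - T| * (`|x| + 1))).
    by rewrite ler_wpM2l// lerDl.
  by rewrite -ltr_pdivlMr// ltr_wpDl.
pose L x := lim ((fun T : operator E F => T x) @ G).
have Lcvg x : (fun T : operator E F => T x) @ G --> L x by exact: appc.
have Llin : linear L.
  move=> a x y; apply: cvg_lim => //.
  rewrite (_ : (fun T : operator E F => _) = fun T => a *: T x + T y); last first.
    by apply/funext => T; rewrite linearP.
  by apply: cvgD (Lcvg y); apply: cvgZl_tmp (Lcvg x).
pose Lin := HB.pack L (GRing.isLinear.Build R E F *:%R L Llin) : {linear E -> F}.
have Lnear T0 e x : G (ball T0 e) -> `|T0 x - L x| <= e * `|x|.
  move=> GT0.
  apply: (@closed_cvg _ _ G _ (fun T : operator E F => T x)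
    [set y | `|T0 x - y| <= e * `|x|]) _ _ _ (Lcvg x).
    rewrite (_ : mkset _ = (fun y => `|T0 x - y|) @^-1` [set r | r <= e * `|x|])//.
    apply: closed_comp (@closed_le _ _) => y _.
    by apply: cvg_norm; apply: cvgB; [exact: cvg_cst|exact: cvg_id].
  apply: filterS GT0 => T; rewrite -ball_normE /ball_/= => T0T.
  by apply: le_trans (le_operator_dist _ _ _) _; rewrite ler_wpM2r// ltW.
have Lcont : continuous L.
  apply: (@bounded_linear_continuous _ _ _ Lin); apply/bounded_funP => r.
  have [T0 GT0] := Gc 1 ltr01; exists ((`|T0| + 1) * r) => x xr.
  rewrite /= -[L x](subKr (T0 x)) (le_trans (ler_normB _ _))//.
  apply: (@le_trans _ _ ((`|T0| + 1) * `|x|)); last by rewrite ler_wpM2l.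
  by rewrite mulrDl lerD// ?le_opnorm// Lnear.
have Lop : L \in @is_operator R E F by rewrite inE.
apply/cvg_ex; exists (Operator Lop); apply/cvgrPdist_le => e e0.
have e20 : 0 < e / 2 by rewrite divr_gt0.
have [T0 GT0] := Gc _ e20.
near=> T.
apply: opnorm_le => x x1; rewrite operatorBE /=.
rewrite (le_trans (ler_distD (T0 x) _ _))// [leRHS]splitr lerD//.
  rewrite distrC (le_trans (Lnear _ _ _ GT0))//.
  by rewrite ler_piMr// ltW.
have T0T : ball T0 (e / 2) T by near: T.
move: T0T; rewrite -ball_normE /ball_/= => /ltW T0T.
apply: le_trans (le_operator_dist _ _ _) _; apply: le_trans T0T.
by rewrite ler_piMr.
Unshelve. all: by end_near. Qed.

HB.instance Definition _ :=
  Uniform_isComplete.Build (operator E F) operator_complete.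

End OperatorComplete.

(* R^o is R as a normed space over itself. *)
Notation dual X := (operator X (Real.sort _)^o).

Lemma closure_normP (R : realType) (V : normedModType R) (A : set V) (x : V) :
  closure A x <-> forall e, 0 < e -> exists2 y, A y & `|x - y| < e.
Proof.
split=> [cA e e0|Ax U /nbhs_normP[e /= e0 eU]].
  by have [y [Ay xy]] := cA _ (nbhsx_ballx x e e0); exists y; rewrite // -ball_normE in xy.
by have [y Ay xy] := Ax _ e0; exists y; split=> //; apply: eU.
Qed.

Section OperatorConstructions.
Context {R : realType}.

Lemma bounded_is_operator (E F : normedModType R) (f : E -> F) (M : R) :
  linear f -> (forall x, `|f x| <= M * `|x|) -> f \in @is_operator R E F.
Proof.
move=> lf fM; rewrite inE; split=> //.
pose g := HB.pack f (GRing.isLinear.Build R E F *:%R f lf) : {linear E -> F}.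
apply: (@bounded_linear_continuous _ _ _ g); apply/bounded_funP => r.
exists (`|M| * r) => x xr; apply: le_trans (fM x) _.
by apply: (@le_trans _ _ (`|M| * `|x|)); rewrite ?ler_wpM2r ?ler_wpM2l ?ler_norm.
Qed.

Lemma id_is_operator (E : normedModType R) : idfun \in @is_operator R E E.
Proof. by rewrite inE; split => // x; exact: cvg_id. Qed.

Definition id_operator (E : normedModType R) : operator E E :=
  Operator (id_is_operator E).

Lemma eval_is_operator (E : normedModType R) (x : E) :
  (fun phi : dual E => phi x) \in @is_operator R (dual E) R^o.
Proof.
apply: (@bounded_is_operator _ _ _ `|x|) => [a f g //|f].
by rewrite mulrC; exact: le_opnorm.
Qed.

Definition eval_operator (E : normedModType R) (x : E) : dual (dual E) :=
  Operator (eval_is_operator x).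

Variables X Y : normedModType R.

Lemma tensor_is_operator (x : X) (y : Y) :
  (fun phi : dual X => phi x *: eval_operator y)
    \in @is_operator R (dual X) (dual (dual Y)).
Proof.
apply: (@bounded_is_operator _ _ _ (`|x| * `|eval_operator y|)).
  by move=> a f g; rewrite scalerA -scalerDl.
move=> f; rewrite normrZ mulrAC ler_wpM2r// mulrC.
exact: le_opnorm.
Qed.

(* The elementary tensor x (x) y is identified with the bounded bilinear form
   (phi, psi) |-> phi x * psi y on X^* x Y^*, and bounded bilinear forms are
   curried: B(X^* x Y^* ) = L(X^*, L(Y^*, R)) isometrically. *)
Definition tensor (x : X) (y : Y) : operator (dual X) (dual (dual Y)) :=
  Operator (tensor_is_operator x y).

Lemma tensorE x y phi psi : tensor x y phi psi = phi x * psi y.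
Proof. by []. Qed.

(* The canonical image of the algebraic tensor product of X and Y; the map from
   the latter is injective because X^* and Y^* separate points. *)
Definition alg_tensor : set (operator (dual X) (dual (dual Y))) :=
  range (fun s : seq (X * Y) => \sum_(p <- s) tensor p.1 p.2).

Lemma alg_tensor_submod : alg_tensor 0 /\
  forall a u v, alg_tensor u -> alg_tensor v -> alg_tensor (a *: u + v).
Proof.
split; first by exists [::] => //; rewrite big_nil.
move=> a _ _ [s _ <-] [t _ <-].
exists ([seq (a *: p.1, p.2) | p <- s] ++ t) => //.
rewrite big_cat big_map scaler_sumr; congr (_ + _); apply: eq_bigr => p _.
apply: operatorP => phi; apply: operatorP => psi.
by rewrite !(tensorE, operatorZE) /= linearZ /= scalerA.
Qed.

(* The norm induced on the algebraic tensor product is the injective norm. *)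
Lemma alg_tensor_normE (s : seq (X * Y)) :
  `|\sum_(p <- s) tensor p.1 p.2| =
  sup [set r | exists (phi : dual X) (psi : dual Y),
    [/\ `|phi| <= 1, `|psi| <= 1 & r = `|\sum_(p <- s) phi p.1 * psi p.2| ]].
Proof.
set u := \sum_(p <- s) _; set A := (X in sup X).
have uE phi psi : u phi psi = \sum_(p <- s) phi p.1 * psi p.2.
  by rewrite /u operator_sumE operator_sumE.
have ubA : ubound A `|u|.
  move=> _ [phi [psi [phi1 psi1 ->]]]; rewrite -uE.
  exact: le_trans (le_opnorm1 _ psi1) (le_opnorm1 u phi1).
have A0 : A !=set0.
  by exists `|u 0 0|, 0, 0; rewrite -uE !normr0; split => //; exact: ler01.
apply/eqP; rewrite eq_le; apply/andP; split; last exact: ge_sup.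
apply: opnorm_le => phi phi1; apply: opnorm_le => psi psi1.
apply: sup_upper_bound; first by split=> //; exists `|u|.
by exists phi, psi; rewrite uE.
Qed.

(* The injective tensor product is the completion of the algebraic one for the
   injective norm, i.e. its closure in the Banach space L(X^*, L(Y^*, R)). *)
Definition in_inj_tensor : {pred operator (dual X) (dual (dual Y))} :=
  mem (closure alg_tensor).

Record inj_tensor := InjTensor {
  inj_tensor_val :> operator (dual X) (dual (dual Y));
  inj_tensorP : inj_tensor_val \in in_inj_tensor }.

HB.instance Definition _ := [isSub for inj_tensor_val].
HB.instance Definition _ := [Choice of inj_tensor by <:].

Lemma in_inj_tensor_submod_closed : submod_closed in_inj_tensor.
Proof.
have [at0 atD] := alg_tensor_submod.
split; first by rewrite inE; exact: subset_closure.
move=> a u v; rewrite !inE => /closure_normP uc /closure_normP vc.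
apply/closure_normP => e e0.
have e20 : 0 < e / 2 by rewrite divr_gt0.
have d0 : 0 < e / 2 / (`|a| + 1) by rewrite divr_gt0// ltr_wpDl.
have [u' Au' uu'] := uc _ d0.
have [v' Av' vv'] := vc _ e20.
exists (a *: u' + v'); first exact: atD.
rewrite opprD addrACA -scalerBr (le_lt_trans (ler_normD _ _))//.
rewrite [ltRHS]splitr ler_ltD// normrZ.
apply: (@le_trans _ _ ((`|a| + 1) * `|u - u'|)).
  by rewrite ler_wpM2r// lerDl.
by rewrite mulrC -ler_pdivlMr ?ltW// ltr_wpDl.
Qed.

HB.instance Definition _ := GRing.isSubmodClosed.Build R
  (operator (dual X) (dual (dual Y))) in_inj_tensor in_inj_tensor_submod_closed.
HB.instance Definition _ := [SubChoice_isSubLmodule of inj_tensor by <:].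

Definition inj_tensor_norm (u : inj_tensor) : R := `|inj_tensor_val u|.

Lemma ler_inj_tensor_normD u v :
  inj_tensor_norm (u + v) <= inj_tensor_norm u + inj_tensor_norm v.
Proof. exact: ler_normD. Qed.

Lemma inj_tensor_normZ a u : inj_tensor_norm (a *: u) = `|a| * inj_tensor_norm u.
Proof. exact: normrZ. Qed.

Lemma inj_tensor_norm0_eq0 u : inj_tensor_norm u = 0 -> u = 0.
Proof. by move=> /normr0_eq0 u0; exact: val_inj. Qed.

HB.instance Definition _ := @Lmodule_isNormed.Build R inj_tensor
  inj_tensor_norm ler_inj_tensor_normD inj_tensor_normZ inj_tensor_norm0_eq0.

Lemma inj_tensor_complete (G : set_system inj_tensor) :
  ProperFilter G -> cauchy G -> cvg G.
Proof.
move=> GF /cauchyP Gc.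
have /cvg_ex[l vl] : cvg (inj_tensor_val @ G).
  apply: cauchy_cvg; apply/cauchyP => e e0.
  have [u Gu] := Gc _ e0; exists (inj_tensor_val u).
  change (G [set v | ball (inj_tensor_val u) e (inj_tensor_val v)]).
  by apply: filterS Gu => v; rewrite /= -!ball_normE.
have lc : l \in in_inj_tensor.
  rewrite inE; apply: (@closed_cvg _ _ G _ inj_tensor_val) vl.
    exact: closed_closure.
  by apply: nearW => u; have := inj_tensorP u; rewrite inE.
apply/cvg_ex; exists (InjTensor lc); apply/cvgrPdist_lt => e e0.
by move/cvgrPdist_lt : vl => /(_ e e0).
Qed.

HB.instance Definition _ :=
  Uniform_isComplete.Build inj_tensor inj_tensor_complete.

End OperatorConstructions.

Section Topologies.
Context {R : realType}.

(* Strong operator topology on L(Z). *)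
Definition sot (Z : normedModType R) :=
  initial_topology (fun T : operator Z Z => (T : {ptws Z -> Z})).
HB.instance Definition _ (Z : normedModType R) := Topological.on (sot Z).

Definition separable_set (T : topologicalType) (A : set T) :=
  exists D : set T, [/\ countable D, D `<=` A & A `<=` closure D].

Definition BSAP (lambda : R) (Z : completeNormedModType R) :=
  closure [set T : sot Z | `|T : operator Z Z| <= lambda /\
                           separable_set (range (T : operator Z Z))]
    (id_operator Z : sot Z).

Definition property_C (Z : completeNormedModType R) :=
  forall C : set (set Z),
    (forall A, C A -> convex_set A /\ closed A) ->
    \bigcap_(A in C) A = set0 ->
    exists D : set (set Z),
      [/\ D `<=` C, countable D & \bigcap_(A in D) A = set0].

Definition weak_star (X : normedModType R) :=
  initial_topology (fun f : dual X => (f : {ptws X -> R^o})).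
HB.instance Definition _ (X : normedModType R) := Topological.on (weak_star X).

Definition dual_ball (X : normedModType R) :=
  set_type [set f : weak_star X | `|f : dual X| <= 1].
HB.instance Definition _ (X : normedModType R) := Topological.on (dual_ball X).

Lemma dual_ball0 (X : normedModType R) :
  (0 : dual X) \in [set f : weak_star X | `|f : dual X| <= 1].
Proof. by rewrite inE /= normr0. Qed.

HB.instance Definition _ (X : normedModType R) :=
  isPointed.Build (dual_ball X) (exist _ (0 : dual X) (dual_ball0 X)).

Definition borel (K : ptopologicalType) := g_sigma_algebraType (@open K).

Definition regular_measure (K : ptopologicalType)
    (mu : {measure set (borel K) -> \bar R}) :=
  forall A : set (borel K), measurable A ->
    mu A = ereal_sup [set mu C | C in [set C : set K | compact C /\ C `<=` A]] /\
    mu A = ereal_inf [set mu U | U in [set U : set K | open U /\ A `<=` U]].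

(* LspaceType1 mu is the space of classes of a.e. equal integrable functions,
   which the library does not endow with a topology. *)
Definition L1_separable d (T : measurableType d)
    (mu : {measure set T -> \bar R}) :=
  exists D : set (LspaceType1 mu), countable D /\
    forall (f : LspaceType1 mu) (e : R), 0 < e ->
      exists2 g, D g & ('N[mu]_1[EFin \o (fun x => f x - g x)%R] < e%:E)%E.

Definition class_MS (K : ptopologicalType) :=
  [/\ compact [set: K], hausdorff_space K &
    forall mu : probability (borel K) R, regular_measure mu -> L1_separable mu].

End Topologies.

Arguments class_MS R K : clear implicits.

(* Main.v *)
(** Write K for the dual ball with its weak-star topology. Given a regular Borel
probability mu on K, to a Borel map r : K -> K with finitely many values attach
the functional
  D_r(z) = \int z(k - r k, k - r k) d mu(k)
on the injective tensor product of X with itself. Choosing r so that finitely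
many x in X vary little between k and r k makes D_r(z) as small as desired, so
the closed half-spaces [D_r >= 1] have empty intersection. By property (C)
countably many r_n already suffice, i.e. every z satisfies D_{r_n}(z) < 1 for
some n. Applied to large multiples of x (x) x, for which D_r(x (x) x) is the
square of the L2-distance from x to x o r, this shows that every x in X is an
L2-limit of functions x o r_n. Hence the superlevel sets of the x's are
approximated in measure by members of a fixed countable family; by compactness
they form a subbase of K, so regularity of mu extends the approximation to all
Borel sets and L1(mu) is separable. *)

Require Import Defs.
From HB Require Import structures.
From mathcomp Require Import all_boot all_order all_algebra.
From mathcomp Require Import all_classical all_reals all_analysis.
From mathcomp Require Import measurable_realfun lra ring.
Set Implicit Arguments.
Unset Strict Implicit.
Unset Printing Implicit Defensive.
Import Order.TTheory GRing.Theory Num.Theory.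
Import numFieldNormedType.Exports HBSimple.
Local Open Scope classical_set_scope.
Local Open Scope ring_scope.

(** * The weak-star compact dual ball *)

Section DualBall.
Context {R : realType} (X : normedModType R).

Definition ball_functional (k : dual_ball X) : dual X := \val k.

Lemma ball_functional_le1 (k : dual_ball X) : `|ball_functional k| <= 1.
Proof. by case: k => f fP; exact: (set_mem fP). Qed.

(** The topology is initial twice over: [dual_ball] is a subspace of [weak_star], itself initial for
    pointwise convergence. Unfolding both turns a neighbourhood of [k] into a pointwise open set. *)
Lemma ball_functional_cvg (F : set_system (dual_ball X)) (k : dual_ball X) :
  Filter F ->
  (forall x,
    (fun l => ball_functional l x) @ F --> (ball_functional k x : R)) ->
  F --> k.
Proof.
move=> FF Fk.
have {}Fk : {ptws, (fun l => ball_functional l : X -> R^o) @ F -->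
    (ball_functional k : X -> R^o)}.
  by apply/pointwise_cvgP => x; exact: Fk.
move=> A [_ [[_ [B Bo <-] <-] /= Bk BA]].
have {}Fk := Fk B; rewrite /= !nbhs_simpl in Fk.
have /Fk : nbhs (ball_functional k : {ptws X -> R^o}) B.
  by apply: open_nbhs_nbhs; split.
by move=> FB; apply: filterS FB => l Bl; exact: BA.
Qed.

Lemma continuous_ball_functional (x : X) :
  continuous (fun k : dual_ball X => ball_functional k x : R).
Proof.
move=> k.
have kc : continuous_at k (fun l => ball_functional l : {ptws X -> R^o}).
  apply: (@continuous_comp (dual_ball X) (weak_star X) {ptws X -> R^o}
    (fun l => \val l) (fun f : dual X => (f : X -> R^o)));
  exact: initial_continuous.
exact: (continuous_comp kc (@proj_continuous X (fun=> R^o) x _)).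
Qed.

Lemma hausdorff_dual_ball : hausdorff_space (dual_ball X).
Proof.
move=> k l kl; apply/val_inj; apply: (@operatorP R X R^o) => x.
apply: (@norm_hausdorff _ R^o) => A B Ak Bl.
have [m [Am Bm]] := kl _ _ (continuous_ball_functional Ak)
  (continuous_ball_functional Bl).
by exists (ball_functional m x).
Qed.

(** Banach-Alaoglu by ultrafilters: the values at each [x] stay in a compact interval and converge,
    and their limits form a linear functional of norm at most 1. *)
Lemma compact_dual_ball : compact [set: dual_ball X].
Proof.
rewrite compact_ultra => F FU _.
have FF : ProperFilter F by exact: ultra_proper.
pose ev x (l : dual_ball X) : R^o := ball_functional l x.
have evle x l : `|ev x l| <= `|x|.
  apply: le_trans (le_opnorm _ _) _.
  by rewrite ler_piMl// ball_functional_le1.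
have lim_ev x : exists a : R^o, ev x @ F --> a.
  have Fx : (ev x @ F) `[- `|x|, `|x|]%classic.
    by apply: nearW => l /=; rewrite in_itv/= -ler_norml.
  have [a [_ Fa]] := @segment_compact R _ _ _ _ Fx.
  (* The cluster value [a] is a limit: otherwise the ultrafilter would contain the preimage of the
     complement of a neighbourhood of [a]. *)
  exists a => B Ba; have [//|FB] := in_ultra_setVsetC (ev x @^-1` B) FU.
  have /Fa/(_ Ba) : (ev x @ F) (~` B) by exact: FB.
  by case=> b [].
pose L x := sval (cid (lim_ev x)).
have Lcvg x : ev x @ F --> L x := svalP (cid (lim_ev x)).
have Llin : linear (L : X -> R^o).
  move=> a x y; apply: (cvg_unique (@norm_hausdorff _ R^o) (Lcvg _)).
  rewrite (_ : ev _ = fun l => a *: ev x l + ev y l); last first.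
    by apply/funext => l; rewrite /ev linearP.
  by apply: cvgD (Lcvg y); apply: cvgZl_tmp (Lcvg x).
have Lle x : `|L x| <= `|x|.
  apply: (@closed_cvg _ _ F _ (ev x) [set b | `|b| <= `|x|]) _ _ _ (Lcvg x).
    by apply: preimage_closed (@closed_le _ _) => b _; exact: norm_continuous.
  by apply: nearW => l; exact: evle.
have Lop : (L : X -> R^o) \in @is_operator R X R^o.
  by apply: (@bounded_is_operator _ _ _ _ 1) => // x; rewrite mul1r.
have Lball : (Operator Lop : weak_star X) \in
    [set f : weak_star X | `|f : dual X| <= 1].
  by apply/mem_set; apply: opnorm_le => x; exact: le_trans (Lle x).
exists (exist _ (Operator Lop : weak_star X) Lball); split=> //.
exact: ball_functional_cvg.
Qed.

End DualBall.

(** * Separability of L1 from a countable dense family of sets *)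

Lemma cvge_lt_ex {R : realType} (u : (\bar R)^nat) (l c : \bar R) :
  u @ \oo --> l -> (l < c)%E -> exists n, (u n < c)%E.
Proof.
move=> ul lc.
have [|n _ un] := ul [set y | (y < c)%E].
  by apply: open_nbhs_nbhs; split => //; exact: open_ereal_lt_ereal.
by exists n; exact: un (leqnn n).
Qed.

Section L1Separability.
Context d (T : measurableType d) {R : realType} (mu : probability T R).
Local Open Scope ereal_scope.
Local Notation Leb0 := {mfun_ mu, T >-> measurableTypeR R}.

Lemma aeEqMfun_ae_eq (f : {mfun T >-> measurableTypeR R}) :
  ((\pi_Leb0%qT f : Leb0) : T -> R) = f %[ae mu].
Proof.
have /eqP := reprK (\pi_Leb0%qT f : Leb0).
by rewrite eqmodE => /asboolP.
Qed.

(** The representative of a class agrees with [f] only almost everywhere, so finiteness of its norm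
    is carried over from [f] by equality of integrals. *)
Lemma LspaceType1_of_integrable (f : T -> R) :
  mu.-integrable [set: T] (EFin \o f) ->
  exists F : LspaceType1 mu, (F : T -> R) = f %[ae mu].
Proof.
move=> intf.
have mf : measurable_fun [set: T] (f : T -> measurableTypeR R).
  exact/measurable_EFinP/(measurable_int mu).
pose f' : {mfun T >-> measurableTypeR R} :=
  HB.pack (f : T -> measurableTypeR R)
    (isMeasurableFun.Build _ _ T (measurableTypeR R) f mf).
pose g : Leb0 := \pi_Leb0%qT f'.
have gf : (g : T -> R) = f' %[ae mu] := aeEqMfun_ae_eq f'.
have mg : measurable_fun [set: T] (g : T -> R).
  exact: (@measurable_funPT _ _ _ _ (repr g)).
have fin_g : finite_norm mu 1 g.
  rewrite /finite_norm Lnorm1.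
  rewrite (@ge0_ae_eq_integral _ _ _ _ _ _ (abse \o (EFin \o f)))//.
  - by case/integrableP : intf.
  - exact/measurableT_comp/measurable_EFinP.
  - exact/measurableT_comp/measurable_EFinP.
  - by move=> x _; exact: abse_ge0.
  - by move: gf; apply: filterS => x gfx _ /=; rewrite gfx.
pose g' : LspaceType1 mu :=
  HB.pack g (isFinLebesgue.Build _ _ _ mu 1 (lexx _) g fin_g).
by exists g'.
Qed.

(** Replaces classes by genuine functions, on which the later approximations operate. *)
Lemma L1_separable_of_dense (G : set (T -> R)) : countable G ->
  (forall g, G g -> mu.-integrable [set: T] (EFin \o g)) ->
  (forall f, mu.-integrable [set: T] (EFin \o f) -> forall e : R, (0 < e)%R ->
    exists2 g, G g & \int[mu]_x `|f x - g x|%:E < e%:E) ->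
  L1_separable mu.
Proof.
move=> cG intG dG.
have /choice[H HP] (g : T -> R) : exists F : LspaceType1 mu,
    G g -> (F : T -> R) = g %[ae mu].
  have [Gg|nGg] := pselect (G g).
    by have [F Fg] := LspaceType1_of_integrable (intG _ Gg); exists F.
  (* Outside [G] the class of zero serves as default value. *)
  have [//|F _] := @LspaceType1_of_integrable (cst 0%R).
    exact: integrable0.
  by exists F => /nGg.
exists (H @` G); split; first exact: sub_countable (card_image_le _ _) _.
move=> f e e0.
have mH (F : LspaceType1 mu) : measurable_fun [set: T] (F : T -> R).
  exact: (@measurable_funPT _ _ _ _ (repr (F : Leb0))).
have intf : mu.-integrable [set: T] (EFin \o (f : T -> R)).
  apply/integrableP; split; first exact/measurable_EFinP.
  by have := @Lebesgue_finite _ _ _ _ _ _ f; rewrite /finite_norm Lnorm1.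
have [g Gg fg] := dG _ intf _ e0.
exists (H g); first by exists g.
have /integrableP[/measurable_EFinP mg _] := intG _ Gg.
rewrite Lnorm1 (@ge0_ae_eq_integral _ _ _ _ _ _ (fun x => `|f x - g x|%:E))//.
- by apply/measurable_EFinP/measurableT_comp => //; exact: measurable_funB.
- by apply/measurable_EFinP/measurableT_comp => //; exact: measurable_funB.
- by move: (HP _ Gg); apply: filterS => x Hgx _ /=; rewrite Hgx.
Qed.

Lemma integral_distD (u1 u2 v1 v2 : T -> R) :
  measurable_fun [set: T] u1 -> measurable_fun [set: T] u2 ->
  measurable_fun [set: T] v1 -> measurable_fun [set: T] v2 ->
  \int[mu]_x `|(u1 x + u2 x) - (v1 x + v2 x)|%:E <=
  \int[mu]_x `|u1 x - v1 x|%:E + \int[mu]_x `|u2 x - v2 x|%:E.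
Proof.
move=> mu1 mu2 mv1 mv2.
have mB (u v : T -> R) : measurable_fun [set: T] u ->
    measurable_fun [set: T] v ->
    measurable_fun [set: T] (fun x => `|u x - v x|%:E).
  move=> mu_ mv; apply/measurable_EFinP/measurableT_comp => //.
  exact: measurable_funB.
rewrite -ge0_integralD//; try exact: mB.
apply: ge0_le_integral => //.
- by apply: mB; exact: measurable_funD.
- by apply: emeasurable_funD; exact: mB.
- by move=> x _; rewrite -EFinD lee_fin opprD addrACA ler_normD.
Qed.

Lemma integral_dist_trans (v u w : T -> R) :
  measurable_fun [set: T] u -> measurable_fun [set: T] v ->
  measurable_fun [set: T] w ->
  \int[mu]_x `|u x - w x|%:E <=
  \int[mu]_x `|u x - v x|%:E + \int[mu]_x `|v x - w x|%:E.
Proof.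
move=> mu_ mv mw; apply: le_trans (integral_distD mu_ mv mv mw).
apply: ge0_le_integral => //.
- apply/measurable_EFinP/measurableT_comp => //; exact: measurable_funB.
- apply/measurable_EFinP/measurableT_comp => //.
  by apply: measurable_funB; exact: measurable_funD.
- by move=> x _; rewrite lee_fin addrKA.
Qed.

(** Pointwise, the integrand is at most [|y - q|] plus [|q|] times the indicator of the symmetric
    difference; the constant integrates to itself since [mu] has mass 1. *)
Lemma integral_dist_indic (y q : R) (A D : set T) :
  measurable A -> measurable D ->
  \int[mu]_x `|y * \1_A x - q * \1_D x|%:E <=
  `|y - q|%:E + `|q|%:E * mu (A `+` D).
Proof.
move=> mA mD.
have mY : measurable (A `+` D).
  by apply: measurableU; exact: measurableD.
have -> : `|y - q|%:E + `|q|%:E * mu (A `+` D) =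
    \int[mu]_x (`|y - q| + `|q| * \1_(A `+` D) x)%:E.
  under eq_integral do rewrite EFinD EFinM.
  rewrite ge0_integralD//.
  - rewrite integral_cst// [X in _ * X + _](probability_setT mu) mule1.
    congr (_ + _).
    rewrite ge0_integralZl//.
    + by rewrite integral_indic// setIT.
    + exact/measurable_EFinP.
  - by apply/measurable_EFinP/measurable_funM.
apply: ge0_le_integral => //.
- apply/measurable_EFinP/measurableT_comp => //.
  by apply: measurable_funB; exact: measurable_funM.
- by apply/measurable_EFinP/measurable_funD => //; exact: measurable_funM.
- move=> x _; rewrite lee_fin !indicE in_setU !in_setD.
  case: (x \in A); case: (x \in D);
    rewrite /= !(mulr1, mulr0, subr0, sub0r, addr0, normrN, normr0)//.
  + by rewrite -{1}(subrK q y) (le_trans (ler_normD _ _)).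
  + by rewrite lerDr.
Qed.

(** Combinations of the [D i] with rational coefficients are indexed by [seq (rat * I)], hence
    countable. They approximate simple functions, one value and its level set at a time. *)
Lemma L1_separable_of_dense_sets (I : countType) (D : I -> set T) :
  (forall i, measurable (D i)) ->
  (forall A, measurable A -> forall e : R, (0 < e)%R ->
    exists i, mu (A `+` D i) < e%:E) ->
  L1_separable mu.
Proof.
move=> mD dD.
pose g (c : seq (rat * I)) x : R := (\sum_(p <- c) ratr p.1 * \1_(D p.2) x)%R.
have mg c : measurable_fun [set: T] (g c).
  apply: measurable_sum => p; exact: measurable_funM.
apply: (@L1_separable_of_dense (range g)).
- exact: sub_countable (card_image_le _ _) _.
- move=> _ [c _ <-]; rewrite /g.
  rewrite (_ : _ \o _ =
      fun x => \sum_(p <- c) ((ratr p.1)%:E * (\1_(D p.2) x)%:E)).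
    by apply: integrable_sum => // p _; exact/integrableZl/integrable_indic.
  by apply/funext => x; rewrite /= -sumEFin.
move=> f intf e e0.
have e20 : (0 < e / 2)%R by rewrite divr_gt0.
have [s [ints _ fs]] := approximation_sfun_integrable measurableT intf.
have [n fn] : exists n, \int[mu]_x `|f x - s n x|%:E < (e / 2)%:E.
  by apply: cvge_lt_ex fs _; rewrite lte_fin.
suff [c sc] : exists c, \int[mu]_x `|s n x - g c x|%:E < (e / 2)%:E.
  exists (g c); first by exists c.
  rewrite [ltRHS](_ : _ = (e / 2)%:E + (e / 2)%:E); last first.
    by rewrite -EFinD -splitr.
  apply: le_lt_trans (lteD fn sc).
  apply: integral_dist_trans => //.
  by have /integrableP[/measurable_EFinP] := intf.
under eq_exists do under eq_integral do rewrite fimfunE fsbig_finite//=.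
(* The tolerance is generalised for an induction on the list of values of [s n], which spends half
   on the head and half on the tail. *)
move: (e / 2)%R e20 => {fn} {}e {}e0.
elim: (finmap.enum_fset _) e e0 => [|y r IH] e e0.
  exists [::]; under eq_integral do rewrite big_nil /g big_nil subrr normr0.
  by rewrite integral0 lte_fin.
have e20 : (0 < e / 2)%R by rewrite divr_gt0.
have e40 : (0 < e / 2 / 2)%R by rewrite divr_gt0.
have [c IHc] := IH _ e20.
have [q yq] : exists q : rat, (`|y - ratr q| < e / 2 / 2)%R.
  have /rat_in_itvoo[q] : (y - e / 2 / 2 < y + e / 2 / 2)%R.
    by rewrite ltrD2l gtrN.
  by rewrite in_itv/= => yq; exists q; rewrite distrC ltr_distl.
(* The [+ 1] keeps the denominator positive when [q] is zero; [|q|] times this bound stays below a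
   quarter of [e]. *)
have d0 : (0 < e / 2 / 2 / (`|ratr q| + 1) :> R)%R.
  by rewrite divr_gt0// ltr_wpDl.
have my : measurable (s n @^-1` [set y]) by [].
have [i yi] := dD _ my _ d0.
exists ((q, i) :: c).
rewrite /g; under eq_integral do rewrite !big_cons.
rewrite [ltRHS](_ : _ = (e / 2)%:E + (e / 2)%:E); last first.
  by rewrite -EFinD -splitr.
apply: le_lt_trans (integral_distD _ _ _ _) _;
  [exact: measurable_funM| |exact: measurable_funM|exact: mg|].
  by apply: measurable_sum => z; exact: measurable_funM.
apply: lteD IHc.
apply: le_lt_trans (integral_dist_indic _ _ _ _) _ => //.
rewrite [ltRHS](_ : _ = (e / 2 / 2)%:E + (e / 2 / 2)%:E); last first.
  by rewrite -EFinD -splitr.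
apply: lteD; first by rewrite lte_fin.
have [->|q0] := eqVneq (ratr q : R) 0%R; first by rewrite normr0 mul0e lte_fin.
apply: (@lt_trans _ _ (`|ratr q|%:E * (e / 2 / 2 / (`|ratr q| + 1))%:E)).
  by rewrite lte_pmul2l// lte_fin normr_gt0.
by rewrite -EFinM lte_fin mulrCA gtr_pMr// ltr_pdivrMr ?ltr_wpDl// mul1r ltrDl.
Qed.

End L1Separability.

(** * Compact spaces with a separating family of functions *)

Lemma measure_lt_halves d (T : measurableType d) (R : realType)
    (mu : {measure set T -> \bar R}) (B B1 B2 : set T) (e : R) :
  measurable B -> measurable B1 -> measurable B2 -> B `<=` B1 `|` B2 ->
  (mu B1 < (e / 2)%:E)%E -> (mu B2 < (e / 2)%:E)%E -> (mu B < e%:E)%E.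
Proof.
move=> mB mB1 mB2 BB B1e B2e.
rewrite (splitr e) EFinD; apply: le_lt_trans (lteD B1e B2e).
apply: le_trans (measureU2 _ mB1 mB2).
by apply: le_measure => //; rewrite inE//; exact: measurableU.
Qed.

Lemma measurable_setY d (T : measurableType d) (A B : set T) :
  measurable A -> measurable B -> measurable (A `+` B).
Proof. by move=> mA mB; apply: measurableU; exact: measurableD. Qed.

(** * Finite unions of finite intersections *)

Section DisjunctiveNormalForm.
Context {T J : Type} (A : J -> set T).

Definition dnf_term (s : seq J) : set T := foldr (fun j B => A j `&` B) setT s.

(** Lists of lists as indices keep the family countable when [J] is countable. *)
Definition dnf (ss : seq (seq J)) : set T :=
  foldr (fun s B => dnf_term s `|` B) set0 ss.

End DisjunctiveNormalForm.

Lemma measurable_dnf_term d (T : measurableType d) (J : Type)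
    (A : J -> set T) s :
  (forall j, measurable (A j)) -> measurable (dnf_term A s).
Proof.
move=> mA; elim: s => [|j s IH] /=; first exact: measurableT.
exact: measurableI.
Qed.

Lemma measurable_dnf d (T : measurableType d) (J : Type) (A : J -> set T) ss :
  (forall j, measurable (A j)) -> measurable (dnf A ss).
Proof.
move=> mA; elim: ss => [|s ss IH] /=; first exact: measurable0.
apply: measurableU IH; exact: measurable_dnf_term.
Qed.

(** The symmetric difference of two intersections, or of two unions, lies in the union of the
    componentwise symmetric differences; the tolerance is halved at each list entry. *)
Lemma dnf_approx d (T : measurableType d) (R : realType) (mu : probability T R)
    (I J : Type) (A : J -> set T) (D : I -> set T) :
  (forall j, measurable (A j)) -> (forall i, measurable (D i)) ->
  (forall j (e : R), 0 < e -> exists i, (mu (A j `+` D i) < e%:E)%E) ->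
  forall ss (e : R), 0 < e -> exists tt, (mu (dnf A ss `+` dnf D tt) < e%:E)%E.
Proof.
move=> mA mD AD.
have termA s (e : R) : 0 < e ->
    exists t, (mu (dnf_term A s `+` dnf_term D t) < e%:E)%E.
  elim: s e => [|j s IH] e e0.
    by exists [::]; rewrite /= /setY setDv setU0 measure0 lte_fin.
  have e20 : 0 < e / 2 by rewrite divr_gt0.
  have [i ji] := AD j _ e20.
  have [t st] := IH _ e20.
  exists (i :: t) => /=.
  have mDt : measurable (dnf_term D t) by exact: measurable_dnf_term.
  have mAs : measurable (dnf_term A s) by exact: measurable_dnf_term.
  apply: measure_lt_halves ji st;
    do ?[apply: measurable_setY | apply: measurableI] => //.
  move=> x [[[Ax sx] /not_andP[nDx|ntx]]|[[Dx tx] /not_andP[nAx|nsx]]].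
  - by left; left.
  - by right; left.
  - by left; right.
  - by right; right.
elim => [|s ss IH] e e0.
  by exists [::]; rewrite /= /setY setDv setU0 measure0 lte_fin.
have e20 : 0 < e / 2 by rewrite divr_gt0.
have [t st] := termA s _ e20.
have [tt sstt] := IH _ e20.
exists (t :: tt) => /=.
have mDt : measurable (dnf_term D t) by exact: measurable_dnf_term.
have mAs : measurable (dnf_term A s) by exact: measurable_dnf_term.
have mDtt : measurable (dnf D tt) by exact: measurable_dnf.
have mAss : measurable (dnf A ss) by exact: measurable_dnf.
apply: measure_lt_halves st sstt;
  do ?[apply: measurable_setY | apply: measurableU] => //.
move=> x [[[sx|ssx] /not_orP[ntx nttx]]|[[tx|ttx] /not_orP[nsx nssx]]].
- by left; left.
- by right; left.
- by left; right.
- by right; right.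
Qed.

(** * Superlevel sets as a subbase of a compact space *)

Section SeparatingFamily.
Context {R : realType} (K : ptopologicalType) (X : Type) (ev : X -> K -> R).
Hypothesis cptK : compact [set: K].
Hypothesis hausK : hausdorff_space K.
Hypothesis ev_cont : forall x, continuous (ev x).
Hypothesis ev_sep : forall k l, k <> l -> exists x, ev x l < ev x k.

Definition evgt (p : X * R) : set K := [set k | p.2 < ev p.1 k].

Lemma open_evgt p : open (evgt p).
Proof.
by apply: (@open_comp _ _ (ev p.1) [set r | p.2 < r]) => // k _; exact: ev_cont.
Qed.

Lemma open_dnf_term_evgt s : open (dnf_term evgt s).
Proof.
by elim: s => [|p s IH] /=; [exact: openT|apply: openI IH; exact: open_evgt].
Qed.

(** Each point outside [U] is separated from [k] by a threshold of some [ev x]. By compactness of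
    the complement of [U] finitely many thresholds suffice, and the matching superlevel sets
    intersect inside [U]. *)
Lemma dnf_term_nbhs (k : K) (U : set K) : open U -> U k ->
  exists2 s, dnf_term evgt s k & dnf_term evgt s `<=` U.
Proof.
move=> oU Uk.
have cW : compact (~` U).
  by apply: (subclosed_compact _ cptK) => //; exact: open_closedC.
(* If [X] is empty, no two points can be separated, so [U] is all of [K] and the empty intersection
   works. *)
have [[x0]|X0] := pselect (inhabited X); last first.
  exists [::] => // l _; apply: contrapT => nUl.
  have [x _] : exists x, ev x l < ev x k.
    by apply: ev_sep => kl; apply: nUl; rewrite -kl.
  by apply: X0.
have /choice[f fP] (l : K) : exists p : X * R,
    ~ U l -> ev p.1 l < p.2 < ev p.1 k.
  have [Ul|nUl] := pselect (U l).
    by exists (x0, 0).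
  have [x xlk] : exists x, ev x l < ev x k.
    by apply: ev_sep => kl; apply: nUl; rewrite -kl.
  by exists (x, (ev x l + ev x k) / 2) => _ /=; rewrite !midf_lt.
pose O l := [set m | ev (f l).1 m < (f l).2].
have oO l : (~` U) l -> open (O l).
  move=> _; apply: (@open_comp _ _ (ev (f l).1) [set r | r < (f l).2]);
    last exact: open_lt.
  by move=> m _; exact: ev_cont.
rewrite compact_cover in cW.
have [|D DU WD] := cW _ _ _ oO.
  by move=> l nUl; exists l => //; case/andP: (fP l nUl).
exists [seq f l | l <- finmap.enum_fset D].
  have : forall l, l \in finmap.enum_fset D -> ~ U l.
    by move=> l /DU; rewrite inE.
  elim: (finmap.enum_fset D) => //= l s IH DU'; split.
    by have /fP/andP[] := DU' l (mem_head _ _).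
  by apply: IH => m ms; apply: DU'; rewrite inE ms orbT.
move=> m Dm; apply: contrapT => /WD[l /= lD].
rewrite /O /=; apply/negP; rewrite -leNgt.
have {}lD : l \in finmap.enum_fset D by [].
elim: (finmap.enum_fset D) lD Dm => //= a s IH.
rewrite inE => /predU1P[<- [/ltW //]|ls [_]]; exact: IH.
Qed.

Lemma dnf_between (C U : set K) : compact C -> open U -> C `<=` U ->
  exists2 ss, C `<=` dnf evgt ss & dnf evgt ss `<=` U.
Proof.
move=> cC oU CU.
have /choice[f fP] (k : K) : exists s,
    C k -> dnf_term evgt s k /\ dnf_term evgt s `<=` U.
  have [Ck|nCk] := pselect (C k); last by exists [::].
  by have [s sk sU] := dnf_term_nbhs oU (CU _ Ck); exists s.
rewrite compact_cover in cC.
have [||D DC CD] := cC _ C (fun k => dnf_term evgt (f k)).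
- by move=> k _; exact: open_dnf_term_evgt.
- by move=> k Ck; exists k => //; have [] := fP _ Ck.
exists [seq f l | l <- finmap.enum_fset D].
  move=> m /CD[l /= lD lm].
  have {}lD : l \in finmap.enum_fset D by [].
  elim: (finmap.enum_fset D) lD => //= a s IH.
  by rewrite inE => /predU1P[<-|/IH]; [left|right].
have : forall l, l \in finmap.enum_fset D -> C l by move=> l /DC; rewrite inE.
elim: (finmap.enum_fset D) => [_ m []|/= l s IH DC']; rewrite subUset; split.
  by have /fP[] := DC' l (mem_head _ _).
by apply: IH => m ms; apply: DC'; rewrite inE ms orbT.
Qed.

(** Regularity squeezes [A] between a compact [C] and an open [U], each within [e / 4] in measure. A
    [dnf] of superlevel sets fits between them, and [dnf_approx] trades it for a [dnf] of the
    [D i]. *)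
Lemma L1_separable_of_dense_subbase (mu : probability (borel K) R)
    (I : countType) (D : I -> set (borel K)) :
  regular_measure mu -> (forall i, measurable (D i)) ->
  (forall p (e : R), 0 < e -> exists i, (mu (evgt p `+` D i) < e%:E)%E) ->
  L1_separable mu.
Proof.
move=> regmu mD dD.
have mopen (U : set K) : open U -> measurable (U : set (borel K)).
  exact: sub_sigma_algebra.
have mevgt p : measurable (evgt p : set (borel K)).
  by apply: mopen; exact: open_evgt.
apply: (@L1_separable_of_dense_sets _ _ _ mu (seq (seq I)) (dnf D)).
  by move=> ss; exact: measurable_dnf.
move=> A mA e e0.
have e20 : 0 < e / 2 by rewrite divr_gt0.
have e40 : 0 < e / 2 / 2 by rewrite divr_gt0.
have finA : mu A \is a fin_num by exact: fin_num_measure.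
have [muA_sup muA_inf] := regmu A mA.
have [C [cC CA] AC] : exists2 C : set K, compact C /\ C `<=` A &
    (mu A - (e / 2 / 2)%:E < mu C)%E.
  have := finA; rewrite muA_sup => /(ub_ereal_sup_adherent e40)[_ [C CA <-]].
  by exists C.
have [U [oU AU] UA] : exists2 U : set K, open U /\ A `<=` U &
    (mu U < mu A + (e / 2 / 2)%:E)%E.
  have := finA; rewrite muA_inf => /(lb_ereal_inf_adherent e40)[_ [U AU <-]].
  by exists U.
have [ss Css ssU] := dnf_between cC oU (subset_trans CA AU).
have mC : measurable (C : set (borel K)).
  rewrite -(setCK C); apply: measurableC; apply: mopen.
  exact: closed_openC (compact_closed hausK cC).
have mU := mopen _ oU.
have mss : measurable (dnf evgt ss : set (borel K)) by exact: measurable_dnf.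
have [tt sstt] := dnf_approx mevgt mD dD ss e20.
have mtt : measurable (dnf D tt) by exact: measurable_dnf.
(* Triangle inequality for symmetric differences, through [dnf evgt ss]. *)
exists tt; apply: (@measure_lt_halves _ _ _ mu _ (A `+` dnf evgt ss)
    _ _ _ _ _ _ _ sstt); do ?[exact: measurable_setY].
  move=> k [[Ak nttk]|[ttk nAk]].
    by have [ssk|nssk] := pselect (dnf evgt ss k); [right; left|left; left].
  by have [ssk|nssk] := pselect (dnf evgt ss k); [left; right|right; right].
(* Both sets lie between [C] and [U], so they differ only within [A] minus [C] or [U] minus [A]. *)
apply: (@measure_lt_halves _ _ _ mu _ (A `\` C) (U `\` A));
  do ?[exact: measurable_setY|exact: measurableD].
- move=> k [[Ak nssk]|[ssk nAk]]; first by left; split=> // /Css.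
  by right; split=> //; exact: ssU.
- rewrite measureD//; last by rewrite ltey_eq finA.
  rewrite setIidr// lteBlDr ?fin_num_measure//.
  by rewrite addeC -lteBlDr.
- rewrite measureD//; last by rewrite ltey_eq fin_num_measure.
  by rewrite setIidr// lteBlDr// addeC.
Qed.

End SeparatingFamily.

(* [f > c + 2t] is nearly all of [f > c] for small [t]; then cut [g] at [c + t]
   and use Chebyshev's inequality. *)
Lemma superlevel_approx d (T : measurableType d) (R : realType)
    (mu : probability T R) (f : T -> R) (G : set (T -> R)) :
  measurable_fun [set: T] f ->
  (forall g, G g -> measurable_fun [set: T] g) ->
  (forall e : R, 0 < e ->
    exists2 g, G g & (\int[mu]_x ((f x - g x) ^+ 2)%:E < e%:E)%E) ->
  forall c e : R, 0 < e -> exists g c', G g /\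
    (mu ([set x | (c < f x)%R] `+` [set x | (c' < g x)%R]) < e%:E)%E.
Proof.
move=> mf mG fG c e e0.
have e20 : 0 < e / 2 by rewrite divr_gt0.
have mgt (g : T -> R) r : measurable_fun [set: T] g ->
    measurable [set x | r < g x].
  by move=> mg; rewrite -[X in measurable X]setTI; exact: measurable_fun_ltr.
(* The band where [f] exceeds [c] by at most [2 / (n + 1)]; these bands decrease to the empty
   set. *)
pose S n := [set x | c < f x] `\` [set x | c + n.+1%:R^-1 *+ 2 < f x].
have mS n : measurable (S n) by apply: measurableD; exact: mgt.
have S0 : \bigcap_n S n = set0.
  rewrite -subset0 => x Sx.
  have cf : c < f x by have [] := Sx 0%N I.
  have fc0 : 0 < (f x - c) / 2 by rewrite divr_gt0// subr_gt0.
  have [n] := ltr_add_invr fc0.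
  rewrite add0r => ncf.
  have [_] := Sx n I; apply.
  by rewrite /= -ltrBrDl mulr2n [ltRHS]splitr ltrD.
have [n Sn] : exists n, (mu (S n) < (e / 2)%:E)%E.
  have : mu \o S @ \oo --> mu (\bigcap_n S n).
    apply: nonincreasing_cvg_mu => //.
    - by rewrite ltey_eq fin_num_measure.
    - by rewrite S0; exact: measurable0.
    move=> m n mn; apply/subsetPset => x [cx nx]; split=> // mx.
    apply: nx; apply: le_lt_trans mx.
    by rewrite lerD2l lerMn2r/= lef_pV2 ?posrE// ler_nat ltnS.
  move=> /cvge_lt_ex; apply; rewrite S0 measure0 lte_fin//.
pose t : R := n.+1%:R^-1.
have t0 : 0 < t by rewrite invr_gt0.
(* Chebyshev's inequality at level [t ^+ 2] divides by [t ^+ 2], so this tolerance leaves [e / 2]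
   for [B]. *)
have [g Gg fg] := fG _ (mulr_gt0 (exprn_gt0 2 t0) e20).
have mg := mG _ Gg.
exists g, (c + t); split => //.
pose B := [set x | ((t ^+ 2)%:E <= `|((f x - g x) ^+ 2)%:E|)%E].
have mfg : measurable_fun [set: T] (fun x => ((f x - g x) ^+ 2)%:E).
  exact/measurable_EFinP/measurable_funX/measurable_funB.
have mB : measurable B.
  rewrite -[B]setTI; apply: emeasurable_fun_c_infty => //.
  exact: measurableT_comp.
apply: (@measure_lt_halves _ _ _ mu _ (S n) B) => //.
- by apply: measurable_setY; exact: mgt.
- have tB x : t <= `|f x - g x| -> B x.
    move=> tfg; rewrite /B/= lee_fin normrX lerXn2r// nnegrE ?normr_ge0//.
    exact: ltW.
  move=> x [[/= cf /negP]|[/= cg /negP]]; rewrite -leNgt => h.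
  + have [fc|fc] := ltP (c + t *+ 2) (f x); last first.
      by left; split=> //; apply/negP; rewrite -leNgt.
    right; apply: tB; apply: le_trans (ler_norm _).
    by rewrite mulr2n in fc; lra.
  + by right; apply: tB; rewrite distrC; apply: le_trans (ler_norm _); lra.
- have := le_integral_abse mu measurableT mfg (exprn_gt0 2 t0).
  rewrite setTI -/B; under eq_integral do rewrite /= ger0_norm ?sqr_ge0//.
  move=> /le_lt_trans /(_ fg); rewrite (EFinM (t ^+ 2)) lte_pmul2l//.
  by rewrite lte_fin exprn_gt0.
Qed.

(** * Finitely-valued Borel maps close to the identity *)

Section Quantizer.
Context {R : realType} (K : ptopologicalType).

(* A pair [Q] encodes the finitely-valued map sending [k] to the point of index
   [Q.1 k] in the list [Q.2]. *)
Definition quantizer (Q : (K -> nat) * seq K) :=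
  measurable_fun [set: borel K] (Q.1 : borel K -> nat) /\
  forall k, (Q.1 k < size Q.2)%N.

Definition quantize (Q : (K -> nat) * seq K) (k : K) : K :=
  nth point Q.2 (Q.1 k).

(** The map factors through the discrete space [nat], on which every function is measurable; hence
    [f] is arbitrary. *)
Lemma measurable_quantize (Q : (K -> nat) * seq K) (f : K -> R) :
  quantizer Q ->
  measurable_fun [set: borel K] (fun k : borel K => f (quantize Q k)).
Proof.
move=> [mQ _].
by apply: (@measurableT_comp _ _ _ _ _ _ (fun i => f (nth point Q.2 i))).
Qed.

Lemma measurable_find (U : K -> set (borel K)) (ls : seq K) :
  (forall l, measurable (U l)) ->
  measurable_fun [set: borel K] (fun k => find (fun l => `[< U l k >]) ls).
Proof.
move=> mU; elim: ls => [|l ls IH]; first exact: measurable_cst.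
apply: measurable_fun_ifT => //.
  apply: (measurable_fun_bool true); rewrite setTI (_ : _ @^-1` _ = U l)//.
  by apply/seteqP; split=> k /= /asboolP.
by apply: (@measurableT_comp _ _ _ _ _ _ S).
Qed.

(** Finitely many of the open sets [U l] cover [K]; [k] is sent to the first listed [l] with [k] in
    [U l]. *)
Lemma quantizer_exists (s : seq (K -> R)) (e : R) : compact [set: K] ->
  (forall f, List.In f s -> continuous f) -> 0 < e ->
  exists Q, quantizer Q /\
    forall k f, List.In f s -> `|f k - f (quantize Q k)| < e.
Proof.
move=> cK sc e0.
pose U l : set K := [set k | forall f, List.In f s -> `|f k - f l| < e].
have oU l : open (U l).
  rewrite /U; elim: s sc {U} => [_|f s IH sc].
    rewrite (_ : mkset _ = setT); first exact: openT.
    by apply/seteqP; split=> // k _ f [].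
  rewrite (_ : mkset _ = [set k | `|f k - f l| < e] `&`
     [set k | forall f, List.In f s -> `|f k - f l| < e]); last first.
    apply/seteqP; split=> k /=.
      by move=> h; split=> [|g gs]; apply: h; [left|right].
    by move=> [fk sk] g [<-//|]; exact: sk.
  apply: openI; last by apply: IH => g gs; apply: sc; right.
  apply: (@open_comp _ _ (fun k => `|f k - f l|) [set r | r < e]) => // k _.
  apply: cvg_norm; apply: cvgB; last exact: cvg_cst.
  by apply: sc; left.
have := cK; rewrite compact_cover => /(_ K setT U).
case=> [l _|k _|D _ DU]; first exact: oU.
  by exists k => //= f _; rewrite subrr normr0.
pose ls := finmap.enum_fset D.
exists (fun k => find (fun l => `[< U l k >]) ls, ls).
have fU k : has (fun l => `[< U l k >]) ls.
  by have [l /= lD lk] := DU k I; apply/hasP; exists l => //; apply/asboolP.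
split; first split.
- by apply: measurable_find => l; exact: sub_sigma_algebra.
- by move=> k; rewrite -has_find.
- by move=> k f fs; have /asboolP := nth_find point (fU k); exact.
Qed.

End Quantizer.

(** * Property (C) of the injective tensor square *)

Section Defect.
Context {R : realType} (X : normedModType R).
Context (mu : probability (borel (dual_ball X)) R).
Local Notation K := (dual_ball X).

Definition displacement (Q : (K -> nat) * seq K) (k : K) : dual X :=
  ball_functional k - ball_functional (quantize Q k).

Lemma displacement_le2 Q k : `|displacement Q k| <= 2.
Proof.
apply: le_trans (ler_normB _ _) _.
by rewrite -[2]/(1 + 1) lerD// ball_functional_le1.
Qed.

Definition defect_density Q (z : inj_tensor X X) (k : K) : R :=
  z (displacement Q k) (displacement Q k).

Lemma defect_densityP Q a (y z : inj_tensor X X) k :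
  defect_density Q (a *: y + z) k =
  a * defect_density Q y k + defect_density Q z k.
Proof.
have valP : inj_tensor_val (a *: y + z) =
    a *: inj_tensor_val y + inj_tensor_val z.
  exact: (linearP (\val : inj_tensor X X -> operator (dual X) (dual (dual X)))).
by rewrite /defect_density valP !(operatorDE, operatorZE).
Qed.

(** Two arguments of norm at most 2 account for the factor 4. *)
Lemma displacement_form_le Q k (B : operator (dual X) (dual (dual X))) :
  `|B (displacement Q k) (displacement Q k)| <= 4 * `|B|.
Proof.
have w2 := displacement_le2 Q k.
apply: le_trans (le_opnorm _ _) _.
apply: (@le_trans _ _ (`|B (displacement Q k)| * 2)).
  by apply: ler_wpM2l => //; exact: opnorm_ge0.
rewrite (_ : 4 * _ = `|B| * 2 * 2); last by ring.
rewrite ler_wpM2r//; apply: le_trans (le_opnorm _ _) _.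
by apply: ler_wpM2l => //; exact: opnorm_ge0.
Qed.

Lemma defect_density_le Q (z : inj_tensor X X) k :
  `|defect_density Q z k| <= 4 * `|z|.
Proof. exact: (displacement_form_le Q k (inj_tensor_val z)). Qed.

Lemma measurable_ball_functional (x : X) :
  measurable_fun [set: borel K] (fun k : borel K => ball_functional k x : R).
Proof.
apply: (measurability _ (RGenOpens.measurableE R)).
move=> _ [_ [a [b ->] <-]]; rewrite setTI.
apply: sub_sigma_algebra; apply: open_comp; last exact: interval_open.
by move=> k _; exact: continuous_ball_functional.
Qed.

Lemma measurable_displacement Q (x : X) : quantizer Q ->
  measurable_fun [set: borel K] (fun k : borel K => displacement Q k x : R).
Proof.
move=> qQ; apply: measurable_funB; first exact: measurable_ball_functional.
exact: (@measurable_quantize _ _ _ (fun k => ball_functional k x)).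
Qed.

Lemma inj_tensor_approx (z : inj_tensor X X) (e : R) : 0 < e ->
  exists s : seq (X * X),
    `|inj_tensor_val z - \sum_(p <- s) tensor p.1 p.2| < e.
Proof.
have /set_mem/closure_normP zc := inj_tensorP z.
by move=> /zc[_ [s _ <-] zs]; exists s.
Qed.

Lemma defect_density_dist Q (z : inj_tensor X X) (s : seq (X * X)) k :
  `|defect_density Q z k -
    \sum_(p <- s) displacement Q k p.1 * displacement Q k p.2| <=
  4 * `|inj_tensor_val z - \sum_(p <- s) tensor p.1 p.2|.
Proof.
have -> : \sum_(p <- s) displacement Q k p.1 * displacement Q k p.2 =
    (\sum_(p <- s) tensor p.1 p.2) (displacement Q k) (displacement Q k).
  by rewrite !operator_sumE.
rewrite /defect_density -!operatorBE; exact: displacement_form_le.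
Qed.

(** The density is a pointwise limit of those of algebraic tensors, which are finite sums of
    products of measurable functions. *)
Lemma measurable_defect_density Q z : quantizer Q ->
  measurable_fun [set: borel K] (defect_density Q z : borel K -> R).
Proof.
move=> qQ.
have /choice[s zs] n := @inj_tensor_approx z n.+1%:R^-1 (harmonic_gt0 n).
pose h n (k : borel K) : R :=
  \sum_(p <- s n) displacement Q k p.1 * displacement Q k p.2.
apply: (@measurable_fun_cvg _ _ _ _ h).
  move=> n; apply: measurable_sum => p.
  by apply: measurable_funM; exact: measurable_displacement.
move=> k _.
apply/cvgrPdist_lt => e e0.
have e40 : 0 < e / 4 by rewrite divr_gt0.
have := @cvg_harmonic R; move/cvgrPdist_lt => /(_ _ e40).
apply: filterS => n /=.
rewrite sub0r normrN ger0_norm ?harmonic_ge0// => ne.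
apply: le_lt_trans (defect_density_dist _ _ _ _) _.
by rewrite mulrC -ltr_pdivlMr//; exact: lt_trans (zs n) ne.
Qed.

Lemma integrable_defect_density Q z : quantizer Q ->
  mu.-integrable [set: borel K] (EFin \o defect_density Q z).
Proof.
move=> qQ; apply: measurable_bounded_integrable => //.
- by rewrite ltey_eq fin_num_measure.
- exact: measurable_defect_density.
- exists (4 * `|z|); split; first exact: num_real.
  move=> M zM k _ /=; exact: le_trans (defect_density_le Q z k) (ltW zM).
Qed.

Definition defect Q z : R := (\int[mu]_k defect_density Q z k)%R.

Lemma linear_defect Q : quantizer Q -> linear (defect Q : _ -> R^o).
Proof.
move=> qQ a y z; rewrite /defect.
under eq_Rintegral do rewrite defect_densityP.
rewrite RintegralD//; last 2 first.
- have := integrableZl measurableT a (integrable_defect_density y qQ).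
  exact.
- exact: integrable_defect_density.
by rewrite RintegralZl//; exact: integrable_defect_density.
Qed.

(** The form with two scalars serves both convex combinations and scaling. *)
Lemma defect_comb Q (a b : R) y z : quantizer Q ->
  defect Q (a *: y + b *: z) = a * defect Q y + b * defect Q z.
Proof.
move=> qQ.
pose L := HB.pack (defect Q : inj_tensor X X -> R^o)
  (GRing.isLinear.Build R (inj_tensor X X) R^o *:%R _ (linear_defect qQ))
  : {linear inj_tensor X X -> R^o}.
by have := linearD L (a *: y) (b *: z); rewrite !linearZ.
Qed.

Lemma defect_le Q z (M : R) : quantizer Q ->
  (forall k, `|defect_density Q z k| <= M) -> `|defect Q z| <= M.
Proof.
move=> qQ zM; apply: le_trans (le_normr_Rintegral _ _) _ => //.
  exact: integrable_defect_density.
apply: (@le_trans _ _ (\int[mu]_k cst M k)%R).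
  apply: le_Rintegral => //.
  - exact: integrable_norm (integrable_defect_density z qQ).
  - exact: finite_measure_integrable_cst.
by rewrite Rintegral_cst//= [X in fine X](probability_setT mu) mulr1.
Qed.

(** An algebraic tensor within [e / 8] of [z] changes the density by at most [e / 2]. In its finite
    sum, the quantizer makes the first factors small, while the second ones are bounded by twice the
    norm of [p.2]. *)
Lemma defect_small z (e : R) : 0 < e ->
  exists Q, quantizer Q /\ `|defect Q z| < e.
Proof.
move=> e0.
have e80 : 0 < e / 2 / 4 by rewrite !divr_gt0.
have [s zs] := inj_tensor_approx z e80.
pose N := \sum_(p <- s) `|p.2| * 2.
have N0 : 0 <= N by apply: sumr_ge0 => p _; rewrite mulr_ge0.
(* With this bound on the first factors the finite sum is at most [e / 4]; the [+ 1] covers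
   [N = 0]. *)
have t0 : 0 < e / 4 / (N + 1) by rewrite !divr_gt0// ltr_wpDl.
pose fs : seq (K -> R) := [seq (fun k => ball_functional k p.1) | p <- s].
have [f|Q [qQ Qs]] := @quantizer_exists _ _ fs _ (@compact_dual_ball R X) _ t0.
  rewrite /fs; elim: s {zs N N0 t0 fs} => //= p s IH [<-|/IH//].
  exact: continuous_ball_functional.
exists Q; split => //.
apply: (@le_lt_trans _ _ (e / 2 + e / 4)); last by lra.
apply: defect_le => // k.
rewrite -(subrK (\sum_(p <- s) displacement Q k p.1 * displacement Q k p.2)
  (defect_density Q z k)).
apply: le_trans (ler_normD _ _) _; apply: lerD.
  apply: le_trans (defect_density_dist _ _ _ _) _.
  by rewrite mulrC -ler_pdivlMr// ltW.
apply: le_trans (ler_norm_sum _ _ _) _.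
apply: (@le_trans _ _ (e / 4 / (N + 1) * N)); last first.
  by rewrite mulrAC ler_pdivrMr ?ltr_wpDl// ler_wpM2l ?lerDl// ltW// divr_gt0.
have {Qs} := Qs k; rewrite /fs /N mulr_sumr.
move: (e / 4 / _) t0 => t t0.
elim: s {N N0 zs fs} => [|p s IH] Qs; first by rewrite !big_nil.
rewrite !big_cons; apply: lerD; last by apply: IH => f fs; apply: Qs; right.
rewrite normrM ler_pM//.
  by apply/ltW; apply: (Qs (fun k => ball_functional k p.1)); left.
rewrite mulrC; apply: le_trans (le_opnorm _ _) _.
by rewrite ler_wpM2r// displacement_le2.
Qed.

Lemma defect_tensor (Q : (K -> nat) * seq K) (x : X) (z : inj_tensor X X) :
  quantizer Q -> inj_tensor_val z = tensor x x ->
  (defect Q z)%:E = (\int[mu]_k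
    ((ball_functional k x - ball_functional (quantize Q k) x) ^+ 2)%:E)%E.
Proof.
move=> qQ zx; rewrite /defect /Rintegral fineK.
  by apply: eq_integral => k _; rewrite /defect_density zx.
exact/integrable_fin_num/integrable_defect_density.
Qed.

Lemma inj_tensor_elementary (x : X) :
  exists z : inj_tensor X X, inj_tensor_val z = tensor x x.
Proof.
have xxP : tensor x x \in @in_inj_tensor R X X.
  rewrite inE; apply: subset_closure; exists [:: (x, x)] => //.
  by rewrite big_seq1.
by exists (InjTensor xxP).
Qed.

End Defect.

(** * Extraction of countably many quantizers, and conclusion *)

Lemma property_C_quantizers (R : realType) (X : completeNormedModType R)
    (mu : probability (borel (dual_ball X)) R) :
  property_C (inj_tensor X X) ->
  exists Q : nat -> (dual_ball X -> nat) * seq (dual_ball X),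
    (forall n, quantizer (Q n)) /\ forall z, exists n, defect mu (Q n) z < 1.
Proof.
move=> pC.
pose H Q : set (inj_tensor X X) := [set z | 1 <= defect mu Q z].
have convH Q : quantizer Q -> convex_set (H Q).
  move=> qQ; apply/convex_setW => y z; rewrite !inE/= => Hy Hz a a0 a1.
  rewrite inE/= /H/= [X in _ <= X](defect_comb mu a%:num (1 - a%:num) y z qQ).
  have ay : 0 <= a%:num * (defect mu Q y - 1).
    by rewrite mulr_ge0 ?subr_ge0// ltW.
  have az : 0 <= (1 - a%:num) * (defect mu Q z - 1).
    by rewrite mulr_ge0 ?subr_ge0// ltW.
  by lra.
have closedH Q : quantizer Q -> closed (H Q).
  move=> qQ; apply: preimage_closed (@closed_ge _ _) => z _.
  have : defect mu Q \in @is_operator R (inj_tensor X X) R^o.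
    apply: (@bounded_is_operator _ _ _ _ 4); first exact: linear_defect.
    by move=> y; apply: defect_le => // k; exact: defect_density_le.
  by rewrite inE => -[_]; exact.
have [||D [DH cD D0]] := pC [set A | exists2 Q, quantizer Q & A = H Q].
- by move=> _ [Q qQ ->]; split; [exact: convH|exact: closedH].
- rewrite -subset0 => z Hz.
  have [Q [qQ]] := defect_small mu z (@ltr01 R).
  apply/negP; rewrite -leNgt; apply: le_trans (ler_norm _).
  by apply: (Hz (H Q)); exists Q.
(* An empty [D] is impossible, since its intersection would be the whole space; otherwise [f]
   enumerates [D]. *)
have [D00|/unsquash f] := pfcard_geP cD.
  by have : [set: inj_tensor X X] 0 by []; rewrite -(bigcap_set0 id) -D00 D0.
have /choice[Q QP] n : exists Q, quantizer Q /\ f n = H Q.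
  by have [Q qQ fn] := DH _ (@funS _ _ _ _ f n I); exists Q.
exists Q; split=> [n|z]; first by have [] := QP n.
apply: contrapT => /forallNP nz.
suff : (set0 : set (inj_tensor X X)) z by [].
rewrite -D0 => A DA.
have [n _ fnA] := @surj _ _ _ _ f _ DA.
have -> : A = H (Q n) by rewrite -fnA; have [] := QP n.
by rewrite /H /= leNgt; apply/negP; exact: nz.
Qed.

Theorem corollary7p7 (R : realType) (X : completeNormedModType R) :
  (exists2 lambda : R, 1 <= lambda & BSAP lambda X) ->
  property_C (inj_tensor X X) ->
  class_MS R (dual_ball X).
Proof.
move=> _ pC; split; [exact: compact_dual_ball|exact: hausdorff_dual_ball|].
move=> mu regmu.
have [Q [qQ Qsmall]] := property_C_quantizers mu pC.
pose ev (x : X) (k : dual_ball X) : R := ball_functional k x.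
(* Preimages of finite index sets under the quantizers: a countable family containing every
   superlevel set of every [x] composed with a quantizer. *)
pose D (i : nat * seq nat) : set (borel (dual_ball X)) :=
  [set k | (Q i.1).1 k \in i.2].
have ev_sep (k l : dual_ball X) : k <> l -> exists x, ev x l < ev x k.
  move=> kl; apply: contrapT => /forallNP nx; apply: kl.
  apply/val_inj; apply: (@operatorP R X R^o) => x.
  have le_ev y : ev y k <= ev y l by rewrite leNgt; apply/negP; exact: nx.
  apply/eqP; rewrite eq_le [X in X && _]le_ev/=.
  (* Evaluations are stable under negation, which gives the reverse inequality. *)
  by have := le_ev (- x); rewrite /ev !linearN lerN2.
apply: (@L1_separable_of_dense_subbase _ _ _ ev _ _ _ ev_sep mu _ D) => //.
- exact: compact_dual_ball.
- exact: hausdorff_dual_ball.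
- exact: continuous_ball_functional.
- move=> [n t]; have [mQ _] := qQ n.
  by have := mQ measurableT [set i | i \in t] I; rewrite setTI.
move=> [x c] e e0.
pose G := [set g : borel (dual_ball X) -> R | exists n,
  g = fun k => ev x (quantize (Q n) k)].
have [||b b0|g [c' [[n ->] cc']]] :=
    @superlevel_approx _ _ _ mu (ev x) G _ _ _ c _ e0.
- exact: measurable_ball_functional.
- by move=> _ [n ->]; exact: measurable_quantize.
- have [z zx] := inj_tensor_elementary x.
  (* Scaling by [b^-1] turns the bound 1 into [b]; the zero summand only matches the shape of
     [defect_comb]. *)
  have [n zn] := Qsmall (b^-1 *: z + 0 *: z).
  exists (fun k => ev x (quantize (Q n) k)); first by exists n.
  rewrite -(defect_tensor mu (qQ n) zx) lte_fin.
  by rewrite defect_comb// mul0r addr0 mulrC ltr_pdivrMr// mul1r in zn.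
(* The indices of the points at which [x] exceeds [c']; by the range condition in [quantizer],
   [iota] contains every index taken. *)
exists (n, [seq i <- iota 0 (size (Q n).2) | c' < ev x (nth point (Q n).2 i)]).
rewrite (_ : D _ = [set k | c' < ev x (quantize (Q n) k)])//.
apply/seteqP; split=> k; rewrite /D/= mem_filter mem_iota /= add0n.
  by case/andP.
by have [_ ->] := qQ n; rewrite andbT.
Qed.
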